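(* Let $k$ and $r$ be integers with $2\le r\le k-2$. Then \[ \binom{k+r}{r}+1\le \chi(K^2(2k+r,k))\le (r+2)\left(3k+\frac{3r+3}{2}\right)^r. \]
   Context: For integers $m\ge 2k$, the Kneser graph $K(m,k)$ is the graph whose vertices are the $k$-element subsets of a fixed $m$-element set, two vertices $A,B$ being adjacent if and only if $A\cap B=\emptyset$. The square $G^2$ of a simple graph $G$ has vertex set $V(G)$, and two distinct vertices are adjacent in $G^2$ if and only if their distance in $G$ is at most $2$. $K^2(m,k)$ denotes the square of $K(m,k)$, and $\chi$ denotes the chromatic number. *)

(* Defs.v *)
From mathcomp Require Import all_boot all_order all_algebra.

Set Implicit Arguments.
Unset Strict Implicit.
Unset Printing Implicit Defensive.

(* A graph is given by its adjacency relation on a finite vertex type. *)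
Section Graphs.
Variables (T : finType) (e : rel T).

(* y is reached from x by a walk with exactly n edges *)
Definition walk (n : nat) (x y : T) : bool :=
  [exists p : n.-tuple T, path e x p && (last x p == y)].

Lemma connect_walk (x y : T) : connect e x y -> exists n, walk n x y.
Proof.
move=> /connectP[p ep ->]; exists (size p).
by apply/existsP; exists (in_tuple p); rewrite ep eqxx.
Qed.

(* The distance is None (infinite) between distinct components. *)
Definition gdist (x y : T) : option nat :=
  if @idP (connect e x y) is ReflectT exy
  then Some (ex_minn (connect_walk exy)) else None.

Definition gsquare : rel T := fun x y =>
  (x != y) && (if gdist x y is Some d then d <= 2 else false).

Definition colorable (n : nat) : bool :=
  [exists f : {ffun T -> 'I_n},
    [forall x, forall y, e x y ==> (f x != f y)]].

(* The minimum ranges over n <= #|T|: a loopless graph is always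
   #|T|-colorable, so this is the least n such that colorable n. *)
Definition chromatic_number : nat :=
  [arg min_(n < (ord_max : 'I_#|T|.+1) | colorable n) (n : nat)].

End Graphs.

Definition kvertex (m k : nat) : finType := {A : {set 'I_m} | #|A| == k}.

Definition kneser (m k : nat) : rel (kvertex m k) :=
  fun A B => [disjoint val A & val B].

(* Main.v *)
(* In the square, two distinct k-sets are non-adjacent exactly when
   1 <= #|A :&: B| < k - r.  Hence the k-subsets of a fixed (k + r)-set,
   together with its complement, form a clique.

   For the upper bound let q be a prime with m <= q <= 3 (m + 1) / 2, where
   m = 2 k + r.  Disjoint k-sets are separated by the classical Kneser colouring
   with r + 2 colours.  Distinct k-sets with #|A :&: B| >= k - r are separated by
   the r coefficients below the leading one of \prod_(a in A) ('X - a) over 'F_q: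
   if they agreed, the difference of the two polynomials would have degree less
   than k - r while vanishing on A :&: B.

   The prime q is found by a Chebyshev-type argument on the ratio
   (6t)! t! / ((3t)! (2t)!^2), which is at least 108^t / (4t).  The exponent of a
   prime p in it counts, with multiplicity 0 or 1, the powers p^i with
   floor (6t / p^i) congruent to 1, 2 or 5 modulo 6.  If no prime lies in
   [4t + 2, 6t], only primes in (2t, 4t + 1], primes at most 6t / 5 and primes at
   most sqrt (6t) contribute; by 'C(2j+1, j) <= 4^j and the bound 4^n on the
   primorial this gives at most (16 * 4^(6/5))^t up to a subexponential factor,
   and 16 * 4^(6/5) < 108. *)
Require Import Defs.
From mathcomp Require Import all_boot all_order all_algebra.
From mathcomp Require Import zify ring lra.
Import Order.TTheory GRing.Theory Num.Theory.

Set Implicit Arguments.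
Unset Strict Implicit.
Unset Printing Implicit Defensive.

(** * Products of primes and the primorial bound *)

Lemma prod_primes_dvdn (a b n : nat) :
    (forall p, prime p -> a <= p < b -> p %| n) ->
  \prod_(a <= p < b | prime p) p %| n.
Proof.
elim: b => [|b IHb] dvd_n; first by rewrite big_geq.
have [lt_b_a | le_a_b] := ltnP b a; first by rewrite big_geq.
rewrite big_mkcond big_nat_recr //= -big_mkcond.
have IH: \prod_(a <= p < b | prime p) p %| n.
  by apply: IHb => p pr_p /andP[le_a_p /ltnW lt_p_b]; apply: dvd_n; rewrite ?le_a_p.
case: ifP => pr_b; last by rewrite muln1.
rewrite Gauss_dvd ?IH ?dvd_n ?le_a_b //=.
rewrite coprime_sym prime_coprime // Euclid_dvd_prod //.
rewrite big_nat_cond big1 // => p /andP[/andP[_ lt_p_b] pr_p].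
by rewrite dvdn_prime2 //; apply/eqP=> eq_bp; rewrite eq_bp ltnn in lt_p_b.
Qed.

(** The two middle coefficients of row 2j + 1 are equal, and together they are at most the row sum 2
    * 4^j. *)
Lemma bin_mid_le (j : nat) : 'C(j.*2.+1, j) <= 4 ^ j.
Proof.
have sum2: 'C(j.*2.+1, j) + 'C(j.*2.+1, j.+1) <= 2 ^ j.*2.+1.
  have lt_j1: j.+1 < j.*2.+2 by lia.
  have lt_j: j < j.*2.+2 by lia.
  rewrite -[2 ^ _]/((1 + 1) ^ _) expnDn (bigD1 (Ordinal lt_j)) // (bigD1 (Ordinal lt_j1)) /=.
    by rewrite !exp1n !muln1; lia.
  by apply/eqP => /(congr1 val) /=; lia.
have eqC: 'C(j.*2.+1, j.+1) = 'C(j.*2.+1, j).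
  by rewrite -(@bin_sub j.*2.+1 j); [congr 'C(_, _); lia | lia].
have e2: 2 ^ j.*2.+1 = 2 * 4 ^ j by rewrite expnS -mul2n expnM.
by rewrite eqC e2 in sum2; lia.
Qed.

(** Each such prime divides (2j + 1)! but neither j! nor (j + 1)!, hence divides 'C(2j+1, j). *)
Lemma prod_primes_upper_half (j : nat) :
  \prod_(j.+2 <= p < j.*2.+2 | prime p) p <= 4 ^ j.
Proof.
apply: leq_trans (bin_mid_le j); apply: dvdn_leq; first by rewrite bin_gt0; lia.
apply: prod_primes_dvdn => p pr_p /andP[lt_j_p le_p_2j].
have: p %| (j.*2.+1)`! by rewrite dvdn_fact // prime_gt0.
rewrite -(@bin_fact j.*2.+1 j); last by lia.
have ndvd_fact n: n < p -> (p %| n`!) = false.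
  move=> lt_n_p; apply/negbTE; rewrite -prime_coprime //.
  elim: n lt_n_p => [|n IHn] lt_n_p; first by rewrite coprimen1.
  rewrite factS coprimeMr IHn ?andbT 1?ltnW // prime_coprime //.
  by apply/negP=> /dvdn_leq; lia.
by rewrite !Euclid_dvdM // !ndvd_fact ?orbF //; lia.
Qed.

Lemma primorial_le (n : nat) : \prod_(0 <= p < n.+1 | prime p) p <= 4 ^ n.
Proof.
have [N] := ubnP n; elim: N n => // N IHN n lt_n_N.
have [|gt2] := leqP n 2; first by case: n {lt_n_N} => [|[|[|n]]] //; rewrite unlock.
have [j n_j] : exists j, n = j.*2 \/ n = j.*2.+1.
  by exists n./2; have := odd_double_half n; case: (odd n) => /= <-; [right | left]; lia.
(* An even n > 2 is not prime, so n - 1 has the same primorial; for n = 2j + 1 the product splits at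
   j + 2 and 4^(j+1) * 4^j = 4^n. *)
case: n_j => n_j; subst n.
  rewrite big_mkcond big_nat_recr //= -big_mkcond ifF.
    have e2j : j.*2 = j.*2.-1.+1 by lia.
    rewrite muln1 {1}e2j (leq_trans (IHN _ _)) ?leq_pexp2l //; lia.
  by apply/negP=> /even_prime; rewrite odd_double; lia.
rewrite (big_cat_nat (n := j.+2)) //=; last by lia.
rewrite -addnn -addnS expnD mulnC.
have -> : (j + j.+1).+1 = j.*2.+2 by lia.
by rewrite leq_mul ?prod_primes_upper_half ?IHN //; lia.
Qed.

(** * The factorial ratio and primes in [4t + 2, 6t] *)

Lemma central_ratio_ge (t : nat) : 0 < t ->
  108 ^ t * ((3 * t)`! * ((2 * t)`! * (2 * t)`!)) <= 4 * t * ((6 * t)`! * t`!).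
Proof.
elim: t => // t IHt _; have [-> //|t_gt0] := posnP t.
have {}IHt := IHt t_gt0.
have F2: (2 * t.+1)`! = (2 * t).+2 * (2 * t).+1 * (2 * t)`!.
  by rewrite mulnS -[2 + _]/((2 * t).+2) !factS mulnA.
have F3: (3 * t.+1)`! = (3 * t).+3 * (3 * t).+2 * (3 * t).+1 * (3 * t)`!.
  by rewrite mulnS -[3 + _]/((3 * t).+3) !factS !mulnA.
have F6: (6 * t.+1)`! = (6 * t + 6) * (6 * t + 5) * (6 * t + 4) *
    (6 * t + 3) * (6 * t + 2) * (6 * t + 1) * (6 * t)`!.
  by rewrite mulnS addnC !addnS !addn0 !factS !mulnA.
rewrite F2 F3 F6 factS expnS; set a := (3 * t)`! in IHt *; set b := (2 * t)`! in IHt *.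
set c := (6 * t)`! in IHt *; set d := t`! in IHt *.
(* Consecutive ratios have quotient 2 (6t+5)(6t+3)(6t+1) / ((t+1)(2t+1)^2), and [coef] bounds it
   below by 108 t / (t+1). The factors t / (t+1) telescope into the loss of order t. *)
have coef: 108 * ((2 * t).+1 * (2 * t).+1) * t
    <= 2 * ((6 * t + 5) * (6 * t + 3) * (6 * t + 1)) by nia.
have num6: (6 * t + 6) * (6 * t + 5) * (6 * t + 4) * (6 * t + 3) * (6 * t + 2) * (6 * t + 1)
    = 8 * ((3 * t).+3 * (3 * t).+2 * (3 * t).+1) * ((6 * t + 5) * (6 * t + 3) * (6 * t + 1)).
  by ring.
rewrite num6; set f := (3 * t).+3 * _ * _; set g := (6 * t + 5) * _ * _ in coef *.
rewrite -(leq_pmul2l t_gt0).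
have := leq_mul (leq_mul coef IHt) (leqnn (4 * f * (t.+1 * t.+1))).
congr (_ <= _); ring.
Qed.

(** At most j + 1 primes lie below 2j + 2, since 2 is the only even one. *)
Lemma prod_primes_leq_exp (F : nat -> nat) (x j : nat) :
    0 < x -> (forall p, prime p -> F p <= x) ->
  \prod_(0 <= p < j.*2.+2 | prime p) F p <= x ^ j.+1.
Proof.
move=> x_gt0 leFx; elim: j => [|j IHj].
  by rewrite unlock /= expn1.
rewrite doubleS big_mkcond (big_nat_recr j.*2.+3) //= (big_nat_recr j.*2.+2) //= -big_mkcond expnSr.
have leF p : (if prime p then F p else 1) <= x by case: ifP => // /leFx.
(* Here both 2 and 3 enter at once; the spare factor x of the empty product below 2 pays for one of
   them. *)
have [-> | j_gt0] := posnP j.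
  by rewrite unlock /= !mul1n leq_mul ?leFx.
rewrite ifF ?muln1 ?leq_mul //.
by apply/negP=> /even_prime; rewrite /= odd_double; lia.
Qed.

Lemma logn_fact_widen (p n N : nat) : prime p -> n <= N ->
  logn p n`! = \sum_(1 <= k < N.+1) n %/ p ^ k.
Proof.
move=> pr_p le_n_N; rewrite logn_fact // [RHS](big_cat_nat (n := n.+1)) //=.
rewrite [X in _ = _ + X]big_nat_cond [X in _ = _ + X]big1 ?addn0 //.
move=> k /andP[/andP[lt_n_k _] _]; rewrite divn_small //.
by rewrite (ltn_trans lt_n_k) // ltn_expl // prime_gt1.
Qed.

Lemma sum_leq_index (N e : nat) : \sum_(1 <= k < N.+1) (k <= e : nat) <= e.
Proof.
suff -> : \sum_(1 <= k < N.+1) (k <= e : nat) = minn N e by rewrite geq_minr.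
elim: N => [|N IHN]; first by rewrite big_geq // min0n.
by rewrite big_nat_recr //= IHN; lia.
Qed.

(** Legendre's formula term by term: only the powers p^k with k <= e may contribute an excess, of at
    most 1 each. *)
Lemma logn_ratio_le (p t e : nat) : prime p ->
    (forall k, 0 < k -> 6 * t %/ p ^ k + t %/ p ^ k
       <= 3 * t %/ p ^ k + (2 * t %/ p ^ k + 2 * t %/ p ^ k) + (k <= e)) ->
  logn p ((6 * t)`! * t`!)
    <= logn p ((3 * t)`! * ((2 * t)`! * (2 * t)`!)) + e.
Proof.
move=> pr_p le_k; rewrite !lognM ?muln_gt0 ?fact_gt0 //.
rewrite !(@logn_fact_widen p _ (6 * t)) //; try lia.
apply: leq_trans (leq_add (leqnn _) (sum_leq_index (6 * t) e)).
rewrite -!big_split /= [leqLHS]big_nat_cond [leqRHS]big_nat_cond; apply: leq_sum => k.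
by rewrite andbT => /andP[/le_k].
Qed.

Lemma floor_ratio_le (t d : nat) : 0 < d ->
  6 * t %/ d + t %/ d <= 3 * t %/ d + (2 * t %/ d + 2 * t %/ d) + (d <= 6 * t).
Proof.
move=> d_gt0; have [le_d | lt_d] := leqP d (6 * t); last first.
  by rewrite !divn_small //; lia.
have := ltn_mod t d; rewrite d_gt0.
(* Since 6 + 1 = 3 + 2 + 2, replacing t by t mod d removes 7q from both sides; finitely many floor
   values remain. *)
rewrite (divn_eq t d) modnMDl modn_mod; set q := t %/ d; set r := t %% d => lt_r.
rewrite !mulnDr !mulnA !divnMDl // (divn_small lt_r).
have h n : n %/ d * d <= n < n %/ d * d + d by rewrite leq_divM -mulSnr ltn_ceil.
have h6 : 6 * r %/ d < 6 by rewrite ltn_divLR //; lia.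
have := h (6 * r).
case: (6 * r %/ d) h6 => [|[|[|[|[|[|?]]]]]] // _ H6;
  have := h (3 * r); case: (3 * r %/ d) => [|[|[|?]]] H3;
  have := h (2 * r); case: (2 * r %/ d) => [|[|[|?]]] H2; lia.
Qed.

(** Here floor(6t / d) is 3 or 4, so primes between 6t/5 and 2t cancel from the ratio. *)
Lemma floor_ratio_mid (t d : nat) : d <= 2 * t -> 6 * t < 5 * d ->
  6 * t %/ d + t %/ d = 3 * t %/ d + (2 * t %/ d + 2 * t %/ d).
Proof.
move=> le_d lt_t; have d_gt0: 0 < d by lia.
have divE n q : q * d <= n < q * d + d -> n %/ d = q.
  by move=> h; apply/eqP; rewrite eqn_leq -ltnS ltn_divLR // leq_divRL // mulSnr andbC.
rewrite (divE t 0) ?(divE (2 * t) 1); try lia.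
have [le2 | lt2] := leqP (2 * d) (3 * t).
  by rewrite (divE (6 * t) 4) ?(divE (3 * t) 2); lia.
by rewrite (divE (6 * t) 3) ?(divE (3 * t) 1); lia.
Qed.

Lemma central_ratio_dvdn (t j : nat) :
    3 * t < 2 * j.+1 ^ 2 -> j.*2.+1 < 4 * t + 2 ->
    (forall p, prime p -> ~~ (4 * t + 2 <= p <= 6 * t)) ->
  (6 * t)`! * t`! %| (3 * t)`! * ((2 * t)`! * (2 * t)`!) *
    (\prod_(0 <= p < j.*2.+2 | prime p) p ^ trunc_log p (6 * t) *
     \prod_((2 * t).+1 <= p < 4 * t + 2 | prime p) p *
     \prod_(0 <= p < (6 * t %/ 5).+1 | prime p) p).
Proof.
move=> lt_t_j lt_j_t noprime; set E := (X in _ %| _ * X).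
apply/dvdn_partP; first by rewrite muln_gt0 !fact_gt0.
move=> p; rewrite mem_primes => /andP[pr_p _]; rewrite p_part.
have p_gt0 := prime_gt0 pr_p; have p_gt1 := prime_gt1 pr_p.
suff [e [le_e dvd_e]] : exists e, (forall k, 0 < k ->
    6 * t %/ p ^ k + t %/ p ^ k
       <= 3 * t %/ p ^ k + (2 * t %/ p ^ k + 2 * t %/ p ^ k) + (k <= e))
    /\ p ^ e %| E.
  apply: (@dvdn_trans (p ^ (logn p ((3 * t)`! * ((2 * t)`! * (2 * t)`!)) + e))).
    by rewrite dvdn_exp2l ?logn_ratio_le.
  by rewrite expnD dvdn_mul ?pfactor_dvdnn.
have dvd_prod (F : nat -> nat) a b : a <= p < b ->
    F p %| \prod_(a <= q < b | prime q) F q.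
  move=> in_ab; rewrite big_mkcond (bigD1_seq p) ?mem_index_iota ?iota_uniq //=.
  by rewrite pr_p dvdn_mulr.
have [small | large] := ltnP p j.*2.+2.
  exists (trunc_log p (6 * t)); split=> [k _|]; last first.
    by rewrite /E -mulnA dvdn_mulr // (dvd_prod (fun q => q ^ _)).
  apply: leq_trans (floor_ratio_le _ _) _; first by rewrite expn_gt0 p_gt0.
  rewrite leq_add2l; case: (leqP (p ^ k)) => //= le_pk.
  by rewrite trunc_log_max.
(* From p >= 2j + 2 and 6t < (2j + 2)^2; beyond this point only k = 1 matters. *)
have p2_big : 6 * t < p ^ 2 by rewrite -mulnn; nia.
have big k : 1 < k -> 6 * t < p ^ k.
  by move=> k_gt1; apply: leq_trans p2_big _; rewrite leq_exp2l.
have zero d c : 6 * t < d -> 6 * t %/ d + t %/ d <= c by move=> lt_d; rewrite !divn_small //; lia.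
have [gt6 | le6] := ltnP (6 * t) p.
  exists 0; split=> [[|k] // _|//]; apply/zero/(leq_trans gt6).
  by rewrite expnS leq_pmulr ?expn_gt0 ?p_gt0.
have lt4 : p < 4 * t + 2 by have := noprime p pr_p; lia.
have one : p %| E -> exists e, (forall k, 0 < k ->
    6 * t %/ p ^ k + t %/ p ^ k
       <= 3 * t %/ p ^ k + (2 * t %/ p ^ k + 2 * t %/ p ^ k) + (k <= e))
    /\ p ^ e %| E.
  move=> dvdE; exists 1; split=> // [[|[|k]]] // _; last exact/zero/big.
  by apply: leq_trans (floor_ratio_le _ _) _; rewrite ?expn1 // leq_add2l leq_b1.
have [lt2 | le2] := ltnP (2 * t) p.
  by apply: one; rewrite /E dvdn_mulr // dvdn_mull // (dvd_prod id) ?lt2.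
have [le5 | lt5] := leqP (p * 5) (6 * t).
  by apply: one; rewrite /E dvdn_mull // (dvd_prod id) // ltnS leq_divRL.
exists 0; split=> // [[|[|k]]] // _; last exact/zero/big.
by rewrite expn1 floor_ratio_mid ?addn0 //; lia.
Qed.

(* The exponents of 2 when [108 ^ t <= 4 * t * E] is raised to the fourth power,
   with [E] the bound of [central_ratio_dvdn], [2 ^ 27 <= 108 ^ 4] and
   [6 * t < 4 * j.+1 ^ 2 <= 2 ^ (2 * c + 2)]. *)
Lemma no_prime_exponents_absurd (t j c : nat) : 72 <= j -> 2 * j ^ 2 <= 3 * t -> 2 ^ c.-1 <= j ->
  27 * t <= 4 * (2 * c + 2 + ((2 * c + 2) * j.+1 + (2 * c + 2 + 4 * t)
    + 2 * (6 * t %/ 5))) -> False.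
Proof.
move=> ge_j le_t le_c; have le5 := leq_divM (6 * t) 5; set u := _ %/ 5 in le5 *.
have [le7 | ] := leqP c 7.
  move=> h; have : (2 * c + 2) * (j + 3) <= 16 * (j + 3) by rewrite leq_mul2r; lia.
  nia.
(* c = 8 is the first value with 14 (c + 1) <= 2^(c-1), namely 126 <= 128; the induction starts
   there. *)
move=> gt7; suff : 14 * c.+1 <= j by nia.
apply: leq_trans le_c; case: c gt7 => // c; rewrite /= ltnS.
elim: c => // c IHc; rewrite leq_eqVlt => /orP[/eqP <- //|/IHc {}IHc].
by rewrite expnS; lia.
Qed.

Lemma leq_exp_trans (m n a b t c : nat) :
  m ^ a <= n ^ b -> n ^ t <= m ^ c -> m ^ (a * t) <= m ^ (b * c).
Proof.
have leX x y e : x <= y -> x ^ e <= y ^ e by case: e => // e le_xy; rewrite leq_exp2r.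
move=> /(leX _ _ t); rewrite -!expnM => le_t /(leX _ _ b); rewrite -!expnM => le_c.
by apply: leq_trans le_t _; rewrite mulnC [b * c]mulnC.
Qed.

(** So 27/4 = 6.75 bounds the binary logarithm of 108 from below, against 4 + 12/5 = 6.4 for the
    terms linear in t of the upper estimate. *)
Lemma pow2_27_le_pow108_4 : 2 ^ 27 <= 108 ^ 4. Proof. lia. Qed.

Lemma prime_between_large (t : nat) : 3456 <= t ->
  exists p, [&& prime p, 4 * t + 2 <= p & p <= 6 * t].
Proof.
move=> ge_t; suff : has (fun p => prime p && (4 * t + 2 <= p)) (iota 0 (6 * t).+1).
  case/hasP=> p; rewrite mem_iota /= => lt_p /andP[pr_p le_p].
  by exists p; rewrite pr_p le_p -ltnS.
apply/negPn/negP=> /hasPn noP.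
have noprime p : prime p -> ~~ (4 * t + 2 <= p <= 6 * t).
  move=> pr_p; apply/negP=> /andP[le4 le6].
  by have := noP p; rewrite mem_iota /= pr_p le4; case/(_ _)/negP => //; lia.
have [j /andP[le_j lt_j]] : exists j, 2 * j ^ 2 <= 3 * t < 2 * j.+1 ^ 2.
  elim: (3 * t) => [|n [j IHj]]; first by exists 0.
  have [?|?] := ltnP n.+1 (2 * j.+1 ^ 2); first by exists j; lia.
  by exists j.+1; rewrite -!mulnn in IHj *; nia.
(* The threshold is exact: 2 * 72^2 = 3 * 3456. *)
have j72 : 72 <= j by rewrite -!mulnn in lt_j le_j; nia.
pose c := up_log 2 j.+1.
have /andP[lt_c le_c] : 2 ^ c.-1 < j.+1 <= 2 ^ c by apply: up_log_bounds => //; lia.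
have [L defL lt_L] : exists2 L, L = 2 * c + 2 & 6 * t < 2 ^ L.
  exists (2 * c + 2) => //.
  apply: leq_trans (_ : (2 ^ c * 2) ^ 2 <= _); last first.
    by rewrite -expnSr -expnM; apply: eq_leq; congr (_ ^ _); lia.
  by rewrite -!mulnn in lt_j *; nia.
apply: (@no_prime_exponents_absurd t j c) => //.
have t_gt0 : 0 < t by lia.
have lt_jt : j.*2.+1 < 4 * t + 2 by rewrite -!mulnn in le_j; nia.
have := central_ratio_dvdn lt_j lt_jt noprime.
set E := (X in _ %| _ * X) => dvdE.
have W_gt0 : 0 < (3 * t)`! * ((2 * t)`! * (2 * t)`!) by rewrite !muln_gt0 !fact_gt0.
have E_gt0 : 0 < E.
  rewrite /E !muln_gt0 -andbA; apply/and3P.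
  by split; apply: prodn_cond_gt0 => p pr_p; rewrite ?expn_gt0 prime_gt0.
have leE : 108 ^ t <= 4 * t * E.
  rewrite -(leq_pmul2r W_gt0); apply: leq_trans (central_ratio_ge t_gt0) _.
  rewrite -(mulnA (4 * t) E) leq_mul // [E * _]mulnC dvdn_leq //.
  by rewrite muln_gt0 W_gt0.
have le_E : 4 * t * E <= 2 ^ (L + (L * j.+1 + (L + 4 * t) + 2 * (6 * t %/ 5))).
  rewrite (expnD 2 L) (expnD 2 (_ * _ + _)) (expnD 2 (L * _)) (expnD 2 L) leq_mul //.
    by rewrite (leq_trans _ (ltnW lt_L)) // leq_mul2r orbT.
  rewrite /E !leq_mul //.
  - rewrite expnM; apply: prod_primes_leq_exp; first by rewrite expn_gt0.
    move=> p pr_p; apply: leq_trans (ltnW lt_L).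
    by rewrite trunc_logP ?prime_gt1 //; lia.
  (* [prod_primes_upper_half] starts at 2t + 2, so the possible prime 2t + 1 is split off and
     bounded by 2^L. *)
  - have tail_le : \prod_((2 * t).+2 <= p < 4 * t + 2 | prime p) p <= 2 ^ (4 * t).
      have -> : 4 * t + 2 = (2 * t).*2.+2 by lia.
      apply: leq_trans (prod_primes_upper_half (2 * t)) _.
      by rewrite -(expnM 2 2) leq_exp2l //; lia.
    rewrite big_mkcond big_ltn; last by lia.
    rewrite -big_mkcond leq_mul //; case: ifP => _; last by rewrite expn_gt0.
    by apply: leq_trans (ltnW lt_L); lia.
  - by rewrite (expnM 2 2) primorial_le.
rewrite -defL -(@leq_exp2l 2 _ _ isT).
exact: leq_exp_trans pow2_27_le_pow108_4 (leq_trans leE le_E).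
Qed.

(** * Primes between m and 3 (m + 1) / 2 *)

(** One link of a chain of primes: q serves every m with q0 < m <= q, as then q0 + 2 <= m + 1;
    larger m pass to the next link. *)
Lemma prime_above_step (q0 q m : nat) : prime q -> 2 * q <= 3 * q0.+2 ->
    (q < m -> exists p, [&& prime p, m <= p & 2 * p <= 3 * m.+1]) ->
  q0 < m -> exists p, [&& prime p, m <= p & 2 * p <= 3 * m.+1].
Proof.
move=> pr_q le_qa next le_am; have [le_mq | lt_qm] := leqP m q.
  by exists q; rewrite pr_q le_mq; lia.
by apply: next; lia.
Qed.

(* [lia] treats [nat] literals above 5000 as opaque, hence the products. *)
Lemma prime_between_small (m : nat) : 9 < m -> m <= 138 * 100 + 41 ->
  exists p, [&& prime p, m <= p & 2 * p <= 3 * m.+1].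
Proof.
move=> ge_m le_m; move: ge_m.
apply: (@prime_above_step _ 13); [by vm_compute | lia | ].
apply: (@prime_above_step _ 19); [by vm_compute | lia | ].
apply: (@prime_above_step _ 31); [by vm_compute | lia | ].
apply: (@prime_above_step _ 47); [by vm_compute | lia | ].
apply: (@prime_above_step _ 73); [by vm_compute | lia | ].
apply: (@prime_above_step _ 109); [by vm_compute | lia | ].
apply: (@prime_above_step _ 163); [by vm_compute | lia | ].
apply: (@prime_above_step _ 241); [by vm_compute | lia | ].
apply: (@prime_above_step _ 359); [by vm_compute | lia | ].
apply: (@prime_above_step _ 541); [by vm_compute | lia | ].
apply: (@prime_above_step _ 811); [by vm_compute | lia | ].
apply: (@prime_above_step _ 1217); [by vm_compute | lia | ].
apply: (@prime_above_step _ 1823); [by vm_compute | lia | ].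
apply: (@prime_above_step _ 2731); [by vm_compute | lia | ].
apply: (@prime_above_step _ 4099); [by vm_compute | lia | ].
apply: (@prime_above_step _ (61 * 100 + 51)); [by vm_compute | lia | ].
apply: (@prime_above_step _ (92 * 100 + 27)); [by vm_compute | lia | ].
apply: (@prime_above_step _ (138 * 100 + 41)); [by vm_compute | lia | ].
by rewrite ltnNge le_m.
Qed.

Lemma prime_between (m : nat) : 10 <= m ->
  exists p, [&& prime p, m <= p & 2 * p <= 3 * m.+1].
Proof.
move=> ge_m; have [le_m | lt_m] := leqP m (138 * 100 + 41).
  exact: prime_between_small.
(* With t = floor((m + 1) / 4), m <= 4t + 2 and 6t <= 3 (m + 1) / 2. *)
have [|p /and3P[pr_p le4 le6]] := @prime_between_large (m.+1 %/ 4); first by lia.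
by exists p; rewrite pr_p; lia.
Qed.

(** * Squares of graphs, colourings and cliques *)

Lemma walk1 (T : finType) (e : rel T) (x y : T) : walk e 1 x y = e x y.
Proof.
apply/existsP/idP => [[p] | exy].
  by case: (tupleP p) => z q; rewrite tuple0 /= andbT => /andP[exz /eqP <-].
by exists [tuple y]; rewrite /= exy eqxx.
Qed.

Lemma walk2 (T : finType) (e : rel T) (x y : T) :
  walk e 2 x y = [exists z, e x z && e z y].
Proof.
apply/existsP/existsP => [[p] | [z /andP[exz ezy]]]; last first.
  by exists [tuple z; y]; rewrite /= exz ezy eqxx.
case: (tupleP p) => z q; case: (tupleP q) => w s; rewrite tuple0 /= andbT.
by case/andP=> /andP[exz ezw] /eqP <-; exists z; rewrite exz.
Qed.

Lemma walk_connect (T : finType) (e : rel T) (n : nat) (x y : T) :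
  walk e n x y -> connect e x y.
Proof. by case/existsP=> p /andP[ep /eqP <-]; apply/connectP; exists p. Qed.

Lemma gsquareE (T : finType) (e : rel T) (x y : T) :
  gsquare e x y = (x != y) && (e x y || [exists z, e x z && e z y]).
Proof.
rewrite /gsquare; have [//|neq_xy /=] := eqVneq x y.
rewrite -(walk1 e x y) -walk2 /gdist; case: {-}_ / idP => [exy | nexy]; last first.
  by symmetry; apply/negbTE/negP => /orP[] w_n; apply: nexy; apply: walk_connect w_n.
case: ex_minnP => n walk_n min_n; apply/idP/orP; last first.
  by case=> /min_n le_n; apply: leq_trans le_n _.
move=> le_n.
case: n walk_n le_n {min_n} => [|[|[|]]] // walk_n _; move: walk_n; [| by left | by right].
by case/existsP=> p; rewrite tuple0 /= (negbTE neq_xy).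
Qed.

Lemma colorableP (T : finType) (e : rel T) (n : nat) :
  reflect (exists f : T -> 'I_n, forall x y, e x y -> f x <> f y) (colorable e n).
Proof.
apply: (iffP existsP) => [[f /forallP col_f] | [f col_f]].
  by exists f => x y exy; move/forallP: (col_f x) => /(_ y); rewrite exy => /eqP.
exists (finfun f); apply/forallP=> x; apply/forallP=> y.
by apply/implyP=> exy; rewrite !ffunE; apply/eqP/col_f.
Qed.

Lemma colorable_finType (T C : finType) (e : rel T) (n : nat) (f : T -> C) :
  #|C| <= n -> (forall x y, e x y -> f x <> f y) -> colorable e n.
Proof.
move=> leCn col_f; apply/colorableP.
exists (fun x => widen_ord leCn (enum_rank (f x))) => x y exy eq_f.
apply: (col_f x y exy); apply: enum_rank_inj; apply: val_inj.
exact: (congr1 val eq_f).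
Qed.

(** The identity colouring is proper by irreflexivity, so the bounded minimum is attained; any n
    above #|T| exceeds it anyway. *)
Lemma chromatic_numberP (T : finType) (e : rel T) : irreflexive e ->
  colorable e (chromatic_number e) /\
  (forall n, colorable e n -> chromatic_number e <= n).
Proof.
move=> irr_e; rewrite /chromatic_number.
have colT : colorable e (ord_max : 'I_#|T|.+1).
  apply: (@colorable_finType T T e _ id) => // x y exy eq_xy.
  by rewrite eq_xy irr_e in exy.
case: arg_minnP => // i col_i min_i; split=> // n col_n.
have [lt_n | ge_n] := ltnP n #|T|.+1; first exact: (min_i (Ordinal lt_n)).
by apply: leq_trans (ltnW ge_n); rewrite -ltnS.
Qed.

Lemma clique_le_chromatic (T : finType) (e : rel T) (S : {set T}) :
    irreflexive e -> {in S &, forall x y, x != y -> e x y} ->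
  #|S| <= chromatic_number e.
Proof.
move=> irr_e cliqueS; have [/colorableP[f col_f] _] := chromatic_numberP irr_e.
rewrite -[leqRHS]card_ord -(card_in_imset (f := f) (D := S)) ?max_card // => x y Sx Sy eq_f.
by apply/eqP/negPn/negP => /(cliqueS x y Sx Sy) /col_f.
Qed.

Lemma gsquare_irr (T : finType) (e : rel T) : irreflexive (gsquare e).
Proof. by move=> x; rewrite /gsquare eqxx. Qed.

(** * Adjacency in the Kneser square and the lower bound *)

Lemma common_disjoint_setP (T : finType) (k r : nat) (A B : {set T}) :
    #|T| = 2 * k + r -> #|A| = k -> #|B| = k ->
  reflect (exists C : {set T}, [/\ #|C| = k, [disjoint A & C] & [disjoint C & B]])
    (k <= #|A :&: B| + r).
Proof.
move=> cT cA cB; have := cardsUI A B; rewrite cA cB => cU.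
(* The complement of the union has |A :&: B| + r elements, and the sets C sought are its
   k-subsets. *)
have := cardsC (A :|: B); rewrite cT => cC.
apply: (iffP idP) => [le_k | [C [cardC dAC dCB]]]; last first.
  have: C \subset ~: (A :|: B).
    by rewrite setCU subsetI -!disjoints_subset disjoint_sym dAC.
  by move/subset_leq_card; lia.
have /card_geqP[s [uniq_s size_s sub_s]] : k <= #|~: (A :|: B)| by lia.
have sAB x : x \in s -> (x \notin A) && (x \notin B).
  by move/sub_s; rewrite !inE negb_or.
exists [set:: s]; split; first by rewrite cardsE (card_uniqP uniq_s).
  rewrite disjoint_sym disjoints_subset.
  by apply/subsetP=> x; rewrite !inE => /sAB/andP[].
by rewrite disjoints_subset; apply/subsetP=> x; rewrite !inE => /sAB/andP[].
Qed.

Lemma gsquare_kneserE (k r : nat) (A B : kvertex (2 * k + r) k) :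
  gsquare (@kneser _ k) A B =
    (A != B) && ([disjoint val A & val B] || (k <= #|val A :&: val B| + r)).
Proof.
rewrite gsquareE; congr (_ && (_ || _)).
have common := common_disjoint_setP (card_ord _) (eqP (valP A)) (eqP (valP B)).
apply/existsP/common => [[C /andP[dAC dCB]] | [C [cC dAC dCB]]].
  by exists (val C); split=> //; apply/eqP/(valP C).
by exists (exist _ C (introT eqP cC)); apply/andP.
Qed.

Lemma kneser_square_clique (k r : nat) : 0 < k ->
  'C(k + r, r) + 1 <= chromatic_number (gsquare (@kneser (2 * k + r) k)).
Proof.
move=> k_gt0.
have /card_geqP[s [uniq_s size_s _]] : k <= #|[set: 'I_(2 * k + r)]|.
  by rewrite cardsT card_ord; lia.
pose D := [set:: s].
have cD : #|D| == k by rewrite cardsE (card_uniqP uniq_s) size_s.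
have cDc : #|~: D| = k + r by rewrite cardsCs setCK card_ord (eqP cD); lia.
pose vD : kvertex (2 * k + r) k := exist _ D cD.
pose S := [set A : kvertex (2 * k + r) k | [disjoint val A & D]].
have vDS : vD \notin S by rewrite inE -setI_eq0 setIid -cards_eq0 (eqP cD) -lt0n.
have cardS : #|S| = 'C(k + r, r).
  rewrite -(card_imset _ val_inj).
  have -> : val @: S = [set A : {set _} | A \subset ~: D & #|A| == k].
    apply/setP=> A; rewrite inE; apply/imsetP/andP => [[B] | [sAD cA]].
      by rewrite inE disjoints_subset => sBD ->; rewrite sBD (valP B).
    by exists (exist _ A cA); rewrite // inE disjoints_subset.
  by rewrite cards_draws cDc -(@bin_sub (k + r) r) ?leq_addl // addnK.
have -> : 'C(k + r, r) + 1 = #|vD |: S| by rewrite cardsU1 vDS cardS addnC.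
apply: clique_le_chromatic; first exact: gsquare_irr.
(* Both sets lie in a (k + r)-set, so they share at least 2k - (k + r) elements. *)
have capD A B : A \in S -> B \in S -> k <= #|val A :&: val B| + r.
  rewrite !inE !disjoints_subset => sA sB.
  have cA := eqP (valP A); have cB := eqP (valP B).
  have cU := cardsUI (val A) (val B); rewrite cA cB in cU.
  have : val A :|: val B \subset ~: D by rewrite subUset sA.
  move/subset_leq_card; rewrite cDc.
  by move: #|_ :|: _| #|_ :&: _| cU => u i; lia.
move=> A B; rewrite !in_setU1 gsquare_kneserE => /predU1P[-> | SA] /predU1P[-> | SB].
- by rewrite eqxx.
- by move=> ->; rewrite inE disjoint_sym in SB; rewrite SB.
- by move=> ->; rewrite inE in SA; rewrite SA.
- by move=> ->; rewrite capD ?orbT.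
Qed.

(** * The colouring for the upper bound *)

(** Its coefficients are, up to sign, the elementary symmetric functions of A modulo q. *)
Definition vanishing_poly (m q : nat) (A : {set 'I_m}) : {poly 'F_q} :=
  (\prod_(a in A) ('X - ((a : nat)%:R)%:P))%R.

Lemma natF_inj (q m : nat) : prime q -> m <= q ->
  injective (fun a : 'I_m => (a : nat)%:R : 'F_q)%R.
Proof.
move=> pr_q le_mq a b /= /(congr1 val) /=; rewrite !val_Fp_nat // !modn_small;
  try exact: leq_trans (ltn_ord _) le_mq.
exact: val_inj.
Qed.

Lemma size_vanishing_poly (m q : nat) (A : {set 'I_m}) :
  size (vanishing_poly q A) = #|A|.+1.
Proof. by rewrite /vanishing_poly -big_enum size_prod_XsubC -cardE. Qed.

Lemma vanishing_poly_monic (m q : nat) (A : {set 'I_m}) :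
  vanishing_poly q A \is monic.
Proof. by apply: monic_prod => a _; apply: monicXsubC. Qed.

Lemma root_vanishing_poly (m q : nat) (A : {set 'I_m}) (a : 'I_m) :
  prime q -> m <= q -> root (vanishing_poly q A) ((a : nat)%:R)%R = (a \in A).
Proof.
move=> pr_q le_mq.
rewrite /vanishing_poly -big_enum /=
  -(big_map (fun a : 'I_m => (a : nat)%:R)%R xpredT (fun z => 'X - z%:P)%R).
by rewrite root_prod_XsubC (mem_map (natF_inj pr_q le_mq)) mem_enum.
Qed.

Lemma top_coefs_inj (m q k r : nat) (A B : {set 'I_m}) :
    prime q -> m <= q -> #|A| = k -> #|B| = k -> k <= #|A :&: B| + r ->
    (forall i, k <= i + r -> i < k ->
       ((vanishing_poly q A)`_i = (vanishing_poly q B)`_i)%R) ->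
  A = B.
Proof.
move=> pr_q le_mq cA cB le_k eq_coef.
suff eqAB : vanishing_poly q A = vanishing_poly q B.
  by apply/setP=> a; rewrite -!(root_vanishing_poly _ a pr_q le_mq) eqAB.
apply/eqP; rewrite -GRing.subr_eq0; apply/eqP.
apply: (@roots_geq_poly_eq0 _ _ [seq (a : nat)%:R%R | a : 'I_m <- enum (A :&: B)]).
- apply/allP=> _ /mapP[a aAB ->]; move: aAB; rewrite mem_enum inE => /andP[Aa Ba].
  rewrite rootE hornerD hornerN.
  by rewrite (eqP (_ : root (vanishing_poly q A) _)) ?(eqP (_ : root (vanishing_poly q B) _))
    ?root_vanishing_poly ?GRing.subrr.
- by rewrite map_inj_uniq ?enum_uniq //; apply: natF_inj.
(* Coefficients of the difference vanish from k - r on: by hypothesis below k, by monicity at k, by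
   degree above. *)
rewrite size_map -cardE; apply: (@leq_trans (k - r)); last by rewrite leq_subLR addnC.
apply/leq_sizeP=> i le_i; rewrite coefB; apply/eqP; rewrite GRing.subr_eq0; apply/eqP.
case: (ssrnat.ltngtP i k) => [lt_i | gt_i | ->]; first by apply: eq_coef; lia.
  by rewrite !nth_default ?size_vanishing_poly ?cA ?cB.
have lead (C : {set 'I_m}) : #|C| = k -> ((vanishing_poly q C)`_k = 1 :> 'F_q)%R.
  move=> cC; have /monicP := vanishing_poly_monic q C.
  by rewrite lead_coefE size_vanishing_poly cC.
by rewrite !lead.
Qed.

(** When A has no element up to r, [find] returns the list length r + 1, the last of the r + 2
    colours. *)
Definition capped_min (m r : nat) (A : {set 'I_m}) : nat :=
  find (fun i => [exists a in A, val a == i]) (iota 0 r.+1).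

Lemma capped_min_lt (m r : nat) (A : {set 'I_m}) : capped_min r A < r.+2.
Proof. by rewrite ltnS -[leqRHS](size_iota 0) find_size. Qed.

(** A common colour up to r is a common element; colour r + 1 puts both sets among the 2k - 1 points
    above r, too few for two disjoint k-sets. *)
Lemma capped_min_disjoint (m k r : nat) (A B : {set 'I_m}) :
    m = 2 * k + r -> #|A| = k -> #|B| = k -> 0 < k -> [disjoint A & B] ->
  capped_min r A <> capped_min r B.
Proof.
move=> def_m cA cB k_gt0 dAB eq_AB.
have [lt_r | ge_r] := ltnP (capped_min r A) r.+1.
  have witness (C : {set 'I_m}) : capped_min r C = capped_min r A ->
      exists2 c, c \in C & val c = capped_min r A.
    move=> eqC; have: has (fun i => [exists a in C, val a == i]) (iota 0 r.+1).
      by rewrite has_find size_iota -/(capped_min r C) eqC.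
    move/(nth_find 0); rewrite -/(capped_min r C) eqC nth_iota // add0n.
    by case/exists_inP=> c Cc /eqP; exists c.
  have [a Aa eq_a] := witness A erefl; have [b Bb eq_b] := witness B (esym eq_AB).
  have eq_ab : a = b by apply: val_inj; rewrite eq_a.
  by move/disjointFr: dAB => /(_ a Aa); rewrite eq_ab Bb.
have high (C : {set 'I_m}) : r < capped_min r C -> forall c, c \in C -> r < val c.
  move=> lt_r c Cc; rewrite ltnNge; apply/negP=> le_c.
  have: has (fun i => [exists a in C, val a == i]) (iota 0 r.+1).
    apply/hasP; exists (val c); first by rewrite mem_iota.
    by apply/exists_inP; exists c.
  by rewrite has_find size_iota ltnNge lt_r.
have {}high c : c \in A :|: B -> r < val c.
  by rewrite inE => /orP[]; apply: high; rewrite -?eq_AB.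
have le_r : r.+1 <= m by lia.
pose W := [set widen_ord le_r i | i : 'I_r.+1].
have cW : #|W| = r.+1.
  rewrite card_imset ?card_ord // => i j /(congr1 val) /= eq_ij.
  exact: val_inj.
have : A :|: B \subset ~: W.
  apply/subsetP=> c /high lt_c; rewrite inE; apply/negP=> /imsetP[i _ eq_c].
  by move: lt_c; rewrite eq_c /= ltnNge -ltnS ltn_ord.
move/subset_leq_card; have := cardsC W; rewrite cW card_ord => cWc.
have /eqP cI : #|A :&: B| == 0 by rewrite cards_eq0 setI_eq0.
have := cardsUI A B; rewrite cI addn0 cA cB => ->.
by rewrite -(leq_add2l r.+1) cWc; lia.
Qed.

Lemma gsquare_kneser_colorable (k r q : nat) : prime q -> 2 * k + r <= q -> 0 < k ->
  colorable (gsquare (@kneser (2 * k + r) k)) (r.+2 * q ^ r).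
Proof.
move=> pr_q le_q k_gt0.
pose f (A : kvertex (2 * k + r) k) : 'I_r.+2 * {ffun 'I_r -> 'F_q} :=
  (Ordinal (capped_min_lt r (val A)),
   [ffun i : 'I_r => ((vanishing_poly q (val A))`_(k - i.+1)%N)%R]).
apply: (@colorable_finType _ _ _ _ f).
  by rewrite card_prod card_ffun card_Fp // !card_ord.
move=> A B; rewrite gsquare_kneserE => /andP[/eqP neq_AB adj] [eq_min /ffunP eq_coef].
have cA := eqP (valP A); have cB := eqP (valP B).
case/orP: adj => [disj | le_k]; first exact: (capped_min_disjoint _ cA cB k_gt0 disj eq_min).
apply: neq_AB; apply: val_inj; apply: (top_coefs_inj pr_q le_q cA cB le_k).
(* Coefficient i is stored at index k - i - 1. *)
move=> i le_i lt_i; have lt_r : k - i.+1 < r by lia.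
have := eq_coef (Ordinal lt_r); rewrite !ffunE /=.
by have -> : k - (k - i.+1).+1 = i by lia.
Qed.

Local Open Scope ring_scope.

Theorem corollary3p4 (k r : nat) (hr : (2 <= r <= k - 2)%N) :
  ('C(k + r, r) + 1 <= chromatic_number (gsquare (@kneser (2 * k + r) k)))%N
  /\
  (chromatic_number (gsquare (@kneser (2 * k + r) k)))%:R
    <= (r%:R + 2%:R) * (3%:R * k%:R + (3%:R * r%:R + 3%:R) / 2%:R) ^+ r :> rat.
Proof.
split; first by apply: kneser_square_clique; lia.
(* The hypotheses force k >= 4, hence 2k + r >= 10; the bound on q is exactly 3k + (3r + 3) / 2. *)
have [|q /and3P[pr_q le_q q_le]] := @prime_between (2 * k + r); first by lia.
have col : colorable (gsquare (@kneser (2 * k + r) k)) (r.+2 * q ^ r).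
  by apply: gsquare_kneser_colorable; lia.
have [_ min_chi] := chromatic_numberP (@gsquare_irr _ (@kneser (2 * k + r) k)).
have := min_chi _ col; rewrite -(ler_nat rat) => /le_trans; apply.
rewrite natrM natrX -addn2 natrD ler_wpM2l ?addr_ge0 ?ler0n //.
have k_ge0 : 0 <= k%:R :> rat := ler0n _ _.
have r_ge0 : 0 <= r%:R :> rat := ler0n _ _.
have q_leR : 2 * q%:R <= 3 * (2 * k%:R + r%:R + 1) :> rat.
  by move: q_le; rewrite -(ler_nat rat) -[(_ + r).+1]addn1 !(natrM, natrD).
by apply: lerXn2r; rewrite ?nnegrE ?ler0n //; lra.
Qed.
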